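(* For every integer $d \ge 1$ there exists a constant $C_1 > 1$ such that, for every non-empty bounded set $\Sigma \subset M(d)$ and every norm $\|\cdot\|$ on $\mathbb{C}^d$, $$\| \Sigma^d \| \le C_1 \, \mathcal{R}(\Sigma) \, \| \Sigma \|^{d-1}.$$
   Context: $M(d)$ is the space of $d\times d$ complex matrices. Given a norm $\|\cdot\|$ on $\mathbb{C}^d$, $M(d)$ is endowed with the operator norm $\|A\| = \sup\{\|Av\| : \|v\|=1\}$. For a non-empty bounded set $\Sigma\subset M(d)$, $\|\Sigma\| = \sup_{A\in\Sigma}\|A\|$, and for an integer $n\ge 1$, $\Sigma^n$ is the set of all products $A_1\cdots A_n$ with all $A_i\in\Sigma$. The joint spectral radius of $\Sigma$ is $\mathcal{R}(\Sigma) = \lim_{n\to\infty}\|\Sigma^n\|^{1/n}$; this limit exists, equals $\inf_n \|\Sigma^n\|^{1/n}$, and does not depend on the chosen norm. Convention: $0^0=1$. *)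

(* Defs.v *)
From HB Require Import structures.
From mathcomp Require Import all_boot all_order all_algebra.
From mathcomp Require Import complex.
From mathcomp Require Import all_classical all_reals all_analysis.

Set Implicit Arguments.
Unset Strict Implicit.
Unset Printing Implicit Defensive.

Import Order.TTheory GRing.Theory Num.Theory.
Import numFieldNormedType.Exports.

Local Open Scope classical_set_scope.
Local Open Scope ring_scope.

(* Nonnegativity follows from the three fields. *)
Record is_norm (R : realType) (d : nat) (N : 'cV[R[i]]_d -> R) : Prop := IsNorm {
  is_norm_triangle : forall u v, N (u + v) <= N u + N v;
  is_norm_homog : forall (a : R[i]) v, N (a *: v) = Normc.normc a * N v;
  is_norm_eq0 : forall v, N v = 0 -> v = 0
}.

Section JointSpectralRadius.
Variables (R : realType) (d : nat) (N : 'cV[R[i]]_d -> R).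
Implicit Types (A : 'M[R[i]]_d) (Sigma : set 'M[R[i]]_d).

Definition op_norm A : R := sup [set N (A *m v) | v in [set v | N v = 1]].

Definition set_norm Sigma : R := sup [set op_norm A | A in Sigma].

Definition set_prod Sigma (n : nat) : set 'M[R[i]]_d :=
  [set \prod_(k < n) A k | A in [set A : 'I_n -> 'M[R[i]]_d |
                                  forall k, Sigma (A k)]].

(* The limit exists, and does not depend on the norm [N], whenever [N] is a
   norm and [Sigma] is non-empty and bounded. The term of index 0 is
   irrelevant. *)
Definition joint_spectral_radius Sigma : R :=
  limn (fun n : nat => set_norm (set_prod Sigma n) `^ n%:R^-1).

End JointSpectralRadius.

(* Main.v *)
Require Import Defs.
From HB Require Import structures.
From mathcomp Require Import all_boot all_order all_algebra.
From mathcomp Require Import perm complex ring lra.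
From mathcomp Require Import all_classical all_reals all_analysis.

Set Implicit Arguments.
Unset Strict Implicit.
Unset Printing Implicit Defensive.

Import Order.TTheory GRing.Theory Num.Theory.
Import numFieldNormedType.Exports.
Local Open Scope classical_set_scope.
Local Open Scope ring_scope.

(** The inequality follows from a comparison of two norms N1 and N2 on C^d:
    if every A in Sigma satisfies N1 (A v) <= s1 N1 v and N2 (A v) <= s2 N2 v,
    then every product of d elements of Sigma is bounded, for N1, by
    C * s2 * s1 ^ (d - 1), with C depending on d only
    ([two_norms_inequality]).  One factor s1 out of d is traded for s2.

    To see this, one takes coordinates in which N1 is comparable to the
    sum of the |x_i| and N2 to the sum of the lam_i |x_i|, for some weights
    lam_i > 0, up to constants depending on d only ([exists_adapted]).  In
    these coordinates the entries of A in Sigma satisfy |a_ij| <= K s1 and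
    lam_i |a_ij| <= K s2 lam_j.  An entry of a product of d matrices is a sum
    over paths i_0, ..., i_d of indices, and the weights cannot increase
    strictly at each of the d steps, as there are only d indices.  At a step
    where lam_i >= lam_j the second bound gives |a_ij| <= K s2; the first
    one is used at the other steps ([entry_prod_le_small]).

    The adapted coordinates are built greedily: the next basis vector almost
    maximizes the ratio N2 / N1 on the common kernel of the coordinate forms
    built so far, and the next form is a functional that almost norms this
    vector for N2.  Such functionals come from an almost Auerbach basis
    ([auerbach]), that is, from almost maximizing a determinant.

    Finally, for every r greater than the joint spectral radius there is a norm
    N2 with N2 (A v) <= r N2 v for all A in Sigma (Rota and Strang,
    [extremal_norm_op_bounded]).  Hence the theorem holds with r in place of the
    joint spectral radius, and r is arbitrarily close to it.  That the limit
    defining the joint spectral radius exists and is an infimum is Fekete's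
    lemma ([fekete]). *)

(** * Norms on finite-dimensional complex spaces *)

Local Notation normc := Normc.normc.

Lemma normc_ge0 (R : realType) (z : R[i]) : 0 <= normc z.
Proof. by case: z => a b; rewrite /normc /=; exact: sqrtr_ge0. Qed.

Lemma normc_sum (R : realType) (I : Type) (r : seq I) (P : pred I)
    (F : I -> R[i]) :
  normc (\sum_(i <- r | P i) F i) <= \sum_(i <- r | P i) normc (F i).
Proof.
elim/big_ind2: _ => [|x u y v hx hy|//]; first by rewrite Normc.normc0.
exact: le_trans (le_normcD _ _) (lerD hx hy).
Qed.

Section Norm.
Variables (R : realType) (d : nat) (N : 'cV[R[i]]_d -> R).
Hypothesis hN : is_norm N.
Let V := 'cV[R[i]]_d.

Lemma is_norm0 : N 0 = 0.
Proof. by rewrite -(scale0r (0 : V)) (is_norm_homog hN) Normc.normc0 mul0r. Qed.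

Lemma is_normN v : N (- v) = N v.
Proof. by rewrite -scaleN1r (is_norm_homog hN) normcN Normc.normc1 mul1r. Qed.

Lemma is_norm_ge0 v : 0 <= N v.
Proof.
have := is_norm_triangle hN v (- v).
by rewrite subrr is_norm0 is_normN -mulr2n pmulrn_lge0.
Qed.

Lemma is_norm_gt0 v : v != 0 -> 0 < N v.
Proof.
move=> v0; rewrite lt_neqAle is_norm_ge0 andbT eq_sym.
by apply: contra v0 => /eqP /(is_norm_eq0 hN) ->.
Qed.

Lemma is_norm_sum (I : Type) (r : seq I) (P : pred I) (F : I -> V) :
  N (\sum_(i <- r | P i) F i) <= \sum_(i <- r | P i) N (F i).
Proof.
elim/big_ind2: _ => [|x u y v hx hy|//]; first by rewrite is_norm0.
exact: le_trans (is_norm_triangle hN _ _) (lerD hx hy).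
Qed.

Lemma is_norm_ler_dist u v : `|N u - N v| <= N (u - v).
Proof.
have h a b : N a - N b <= N (a - b).
  by rewrite lerBlDr -{1}(subrK b a); exact: is_norm_triangle.
have := h v u; have := h u v; rewrite -(is_normN (v - u)) opprB ler_norml; lra.
Qed.

Lemma is_norm_lincomb (I : finType) (x : I -> R[i]) (e : I -> V) :
  N (\sum_i x i *: e i) <= \sum_i normc (x i) * N (e i).
Proof.
apply: le_trans (is_norm_sum _ _ _) _.
by apply: ler_sum => i _; rewrite (is_norm_homog hN).
Qed.

Lemma col_sum_delta (v : V) : v = \sum_i v i 0 *: delta_mx i 0.
Proof.
by rewrite {1}(matrix_sum_delta v); apply: eq_bigr => i _; rewrite big_ord1.
Qed.

Lemma is_norm_le_entries :
  exists2 L, 0 < L & forall v, N v <= L * \sum_i normc (v i 0).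
Proof.
exists (1 + \sum_i N (delta_mx i 0)).
  by rewrite ltr_pwDl // sumr_ge0 // => i _; exact: is_norm_ge0.
move=> v; rewrite {1}(col_sum_delta v).
apply: le_trans (is_norm_lincomb _ _) _; rewrite mulr_sumr.
apply: ler_sum => i _; rewrite mulrC ler_wpM2r ?normc_ge0 //.
rewrite (bigD1 i) //= addrCA lerDl addr_ge0 // sumr_ge0 // => j _.
exact: is_norm_ge0.
Qed.

End Norm.

Lemma normc_le_parts (R : realType) (a b : R) :
  normc (a +i* b)%C <= `|a| + `|b|.
Proof.
rewrite /normc -[leRHS]ger0_norm ?addr_ge0 // -sqrtr_sqr ler_wsqrtr //.
rewrite sqrrD !real_normK ?num_real // addrAC lerDl.
by rewrite mulrn_wge0 ?mulr_ge0.
Qed.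

Lemma normr_entry_le (K : numDomainType) (m n : nat) (A : 'M[K]_(m, n)) i j :
  `|A i j| <= mx_norm A.
Proof.
rewrite mx_normE -[leLHS]nngE num_le.
exact: (le_bigmax _ (fun ij => `|A ij.1 ij.2|%:nng) (i, j)).
Qed.

Lemma lipschitz_continuous (R : realType) (V : normedModType R) (f : V -> R)
    (M : R) :
  0 < M -> (forall x y, `|f x - f y| <= M * `|x - y|) -> continuous f.
Proof.
move=> M0 fM x; apply/cvgrPdist_lt => e e0.
near=> y; apply: le_lt_trans (fM _ _) _; rewrite mulrC -ltr_pdivlMr //.
near: y; apply/nbhs_normP; exists (e / M) => //=; rewrite divr_gt0.
Unshelve. all: by end_near.
Qed.

(** The only use of compactness: seen as a function on R^(2d), the norm is
    Lipschitz, hence attains a positive minimum on the unit sphere of the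
    sup norm. *)
Lemma entries_le_is_norm (R : realType) (d : nat) (N : 'cV[R[i]]_d -> R) :
  is_norm N ->
  exists2 c, 0 < c & forall v : 'cV_d, c * \sum_i normc (v i 0) <= N v.
Proof.
move=> hN; case: d => [|d] in N hN *.
  by exists 1 => // v; rewrite big_ord0 mulr0 (is_norm_ge0 hN).
pose phi (x : 'rV[R]_(d.+1 + d.+1)) : 'cV[R[i]]_d.+1 :=
  \col_i (x 0 (lshift _ i) +i* x 0 (rshift _ i))%C.
have phiB x y : phi (x - y) = phi x - phi y.
  by apply/matrixP => i j; rewrite !mxE.
have phiZ (a : R) x : phi (a *: x) = (a%:C)%C *: phi x.
  by apply/matrixP => i j; rewrite !mxE; simpc.
have entry_le (x : 'rV[R]_(d.+1 + d.+1)) i : `|x 0 i| <= `|x|.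
  exact: normr_entry_le.
have phi_le x : \sum_i normc (phi x i 0) <= (2 * d.+1%:R) * `|x|.
  apply: (@le_trans _ _ (\sum_(i < d.+1) 2 * `|x|)).
    apply: ler_sum => i _; rewrite mxE; apply: le_trans (normc_le_parts _ _) _.
    by rewrite mulr_natl mulr2n lerD.
  by rewrite sumr_const card_ord -[leLHS]mulr_natr [leLHS]mulrAC.
have [L L0 NL] := is_norm_le_entries hN.
pose M := L * (2 * d.+1%:R).
have M0 : 0 < M by rewrite !mulr_gt0.
have fM x : N (phi x) <= M * `|x|.
  by apply: le_trans (NL _) _; rewrite -mulrA ler_pM2l // phi_le.
have fcont : continuous (N \o phi).
  apply: (lipschitz_continuous M0) => x y.
  by apply: le_trans (is_norm_ler_dist hN _ _) _; rewrite -phiB fM.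
pose S : set 'rV[R]_(d.+1 + d.+1) := [set x | `|x| = 1].
have S0 : S !=set0.
  exists (`|const_mx 1 : 'rV[R]_(d.+1 + d.+1)|^-1 *: const_mx 1) => /=.
  rewrite /S /= normrZ normfV normr_id mulVf // normr_eq0.
  apply/eqP => /matrixP /(_ 0 (lshift _ 0)); rewrite !mxE => /eqP.
  by rewrite oner_eq0.
have cS : compact S.
  apply: bounded_closed_compact.
    exists 1; split => // m m1 x /= ->; exact: ltW.
  have -> : S = (fun x : 'rV[R]_(d.+1 + d.+1) => `|x|) @^-1` [set 1] by [].
  apply: closed_comp => [x _|]; last exact: closed_eq.
  exact: norm_continuous.
(* The minimum over the sphere is positive since phi is injective. *)
have [x0 /set_mem Sx0 xmin] := EVT_min_rV S0 cS (continuous_subspaceT fcont).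
have phi0 x : phi x = 0 -> x = 0.
  move=> /matrixP h; apply/rowP => k; rewrite mxE.
  by case: (split_ordP k) => i ->; have := h i 0; rewrite !mxE => -[].
have m0 : 0 < N (phi x0).
  apply: (is_norm_gt0 hN); apply: contraPneq Sx0 => /phi0 ->.
  by rewrite /S /= normr0 => /eqP; rewrite eq_sym oner_eq0.
exists (N (phi x0) / (2 * d.+1%:R)); first by rewrite divr_gt0 ?mulr_gt0.
move=> v; pose x : 'rV[R]_(d.+1 + d.+1) :=
  row_mx (\row_i complex.Re (v i 0)) (\row_i complex.Im (v i 0)).
have -> : v = phi x.
  apply/matrixP => i j; rewrite mxE /x row_mxEl row_mxEr !mxE ord1.
  by case: (v i 0).
rewrite mulrAC ler_pdivrMr ?mulr_gt0 //.
apply: le_trans (ler_wpM2l (ltW m0) (phi_le x)) _.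
rewrite mulrCA mulrC ler_pM2r ?mulr_gt0 //.
have [->|xn0] := eqVneq x 0; first by rewrite normr0 mulr0 (is_norm_ge0 hN).
have nx0 : 0 < `|x| by rewrite normr_gt0.
rewrite -ler_pdivlMr //.
have Sx : S (`|x|^-1 *: x).
  by rewrite /S /= normrZ normfV normr_id mulVf // normr_eq0.
apply: le_trans (xmin _ (mem_set Sx)) _.
rewrite /= phiZ (is_norm_homog hN) mulrC.
by rewrite /= expr0n addr0 sqrtr_sqr ger0_norm ?invr_ge0.
Qed.

(** * Almost norming functionals *)

(** The factor 2 leaves room to pick a value close to the supremum, so that no
    maximum has to be attained. *)
Lemma near_max (R : realType) (T : Type) (P : set T) (h : T -> R) (x0 : T)
    (B : R) :
  P x0 -> 0 < h x0 -> (forall x, P x -> h x <= B) ->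
  exists x, [/\ P x, 0 < h x & forall y, P y -> h y <= 2 * h x].
Proof.
move=> Px0 h0 hB; pose S := [set h x | x in P].
have hS : has_sup S.
  by split; [exists (h x0), x0|exists B => _ [x Px <-]; exact: hB].
have le_sup y : P y -> h y <= sup S.
  by move=> Py; apply: (ub_le_sup hS.2); exists y.
have s0 : 0 < sup S / 2 by rewrite divr_gt0 // (lt_le_trans h0) // le_sup.
have [_ [x Px <-] hx] := sup_adherent s0 hS.
by exists x; split=> // [|y /le_sup]; lra.
Qed.

Lemma normc_real (R : realType) (a : R) : normc (a%:C)%C = `|a|.
Proof. by rewrite /normc /= expr0n addr0 sqrtr_sqr. Qed.

Lemma normc_prod (R : realType) (I : Type) (r : seq I) (P : pred I)
    (F : I -> R[i]) :
  normc (\prod_(i <- r | P i) F i) = \prod_(i <- r | P i) normc (F i).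
Proof.
elim/big_ind2: _ => [|x u y v <- <-|//]; first exact: Normc.normc1.
exact: Normc.normcM.
Qed.

Lemma normc_det_le (R : realType) (d : nat) (A : 'M[R[i]]_d) (B : R) :
  (forall i j, normc (A i j) <= B) ->
  normc (\det A) <= \sum_(s : {perm 'I_d}) B ^+ d.
Proof.
move=> AB; apply: le_trans (normc_sum _ _ _) _; apply: ler_sum => s _.
rewrite Normc.normcM normc_prod.
have -> : normc ((-1) ^+ s : R[i]) = 1.
  by case: (odd_perm s); rewrite ?expr1 ?expr0 ?normcN Normc.normc1.
rewrite mul1r -[in leRHS](card_ord d) -prodr_const.
by apply: ler_prod => i _; rewrite normc_ge0 AB.
Qed.

Section OneNorm.
Variables (R : realType) (d : nat) (N : 'cV[R[i]]_d -> R).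
Hypothesis hN : is_norm N.

Lemma is_norm_normalize v : v != 0 -> N (((N v)^-1)%:C%C *: v) = 1.
Proof.
move=> v0; have Nv := is_norm_gt0 hN v0.
rewrite (is_norm_homog hN) normc_real ger0_norm ?invr_ge0 ?ltW //.
by rewrite mulVf ?gt_eqF.
Qed.

Lemma is_norm_scale_pos v (a : R) : 0 < a -> N ((a%:C)%C *: v) = a * N v.
Proof. by move=> a0; rewrite (is_norm_homog hN) normc_real gtr0_norm. Qed.

Definition replace_col (i : 'I_d) (y : 'cV[R[i]]_d) (V : 'M[R[i]]_d) :=
  \matrix_(a, b) if b == i then y a 0 else V a b.

Lemma det_replace_col i y V : V \in unitmx ->
  \det (replace_col i y V) = \det V * (invmx V *m y) i 0.
Proof.
move=> uV; rewrite /invmx uV -scalemxAl mxE mulrA divrr ?mul1r; last by [].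
rewrite (expand_det_col _ i) mxE; apply: eq_bigr => k _.
rewrite !mxE eqxx mulrC; congr (_ * \det _ * _).
apply/matrixP => a b; rewrite !mxE.
by rewrite eq_sym (negbTE (neq_lift _ _)).
Qed.

(** Take V almost maximizing |det V| among the matrices whose columns lie in
    the unit ball of [N]. By Cramer's rule the coordinates of x in the basis of
    the columns of V are quotients det V' / det V, where V' has x as a column,
    so they are at most 2 on the unit ball. *)
Lemma auerbach : exists2 V : 'M[R[i]]_d, V \in unitmx &
  (forall j, N (col j V) <= 1) /\
  (forall x i, normc ((invmx V *m x) i 0) <= 2 * N x).
Proof.
have [c c0 cN] := entries_le_is_norm hN.
pose P := [set V : 'M[R[i]]_d | forall j, N (col j V) <= 1].
pose t : R := (1 + \sum_j N (delta_mx j 0))^-1.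
have den0 : 0 < 1 + \sum_j N (delta_mx j 0).
  by rewrite ltr_pwDl // sumr_ge0 // => j _; exact: is_norm_ge0.
have t0 : 0 < t by rewrite invr_gt0.
(* A small scalar matrix shows that the determinant is not identically zero on
   P. *)
have Pt : P (t%:C%C)%:M.
  move=> j; have -> : col j (t%:C%C)%:M = (t%:C)%C *: delta_mx j 0.
    by apply/matrixP => a b; rewrite !mxE ord1 andbT mulr_natr.
  rewrite is_norm_scale_pos // /t mulrC ler_pdivrMr // mul1r.
  rewrite (bigD1 j) //= addrCA lerDl addr_ge0 // sumr_ge0 // => l _.
  exact: is_norm_ge0.
have Pent V : P V -> forall i j, normc (V i j) <= c^-1.
  move=> PV i j; rewrite -[leRHS]mul1r ler_pdivlMr // mulrC.
  apply: le_trans (le_trans (cN (col j V)) (PV j)); rewrite ler_pM2l //.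
  rewrite (bigD1 i) //= mxE lerDl sumr_ge0 // => l _; exact: normc_ge0.
have det0 : 0 < normc (\det ((t%:C%C)%:M : 'M[R[i]]_d)).
  rewrite det_scalar -rmorphXn normc_real normr_gt0.
  exact: lt0r_neq0 (exprn_gt0 _ _).
have [V [PV V0 Vmax]] :=
  near_max Pt det0 (fun V PV => normc_det_le (Pent V PV)).
have uV : V \in unitmx.
  rewrite unitmxE unitfE; apply: contraTneq V0 => ->.
  by rewrite Normc.normc0 ltxx.
exists V => //; split=> // x i.
have [->|x0] := eqVneq x 0.
  by rewrite mulmx0 mxE Normc.normc0 mulr_ge0 // is_norm_ge0.
have Nx := is_norm_gt0 hN x0.
pose y := ((N x)^-1%:C)%C *: x.
have Py : P (replace_col i y V).
  move=> j; have [->|ji] := eqVneq j i.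
    have -> : col i (replace_col i y V) = y.
      by apply/matrixP => a b; rewrite !mxE ord1 eqxx.
    by rewrite is_norm_normalize.
  have -> : col j (replace_col i y V) = col j V; last exact: PV.
  by apply/matrixP => a b; rewrite !mxE (negbTE ji).
have := Vmax _ Py; rewrite det_replace_col // Normc.normcM mulrC ler_pM2r //.
rewrite -scalemxAr mxE Normc.normcM normc_real gtr0_norm ?invr_gt0 //.
by rewrite mulrC ler_pdivrMr.
Qed.

(** A Hahn-Banach theorem with the loss of a factor 2d: among the coordinates
    in an Auerbach basis, choose the one that is largest at e. *)
Lemma norming_functional e : e != 0 -> exists2 g : 'rV[R[i]]_d,
  (g *m e) 0 0 = 1 & forall x, normc ((g *m x) 0 0) <= 2 * d%:R * N x / N e.
Proof.
move=> e0; have Ne := is_norm_gt0 hN e0.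
have [V uV [V1 Vx]] := auerbach.
pose y := invmx V *m e.
have Ney : N e <= \sum_i normc (y i 0).
  have -> : e = \sum_i y i 0 *: col i V.
    rewrite -[LHS](mulKVmx uV) -/y; apply/matrixP => a b.
    rewrite mxE summxE; apply: eq_bigr => i _.
    by rewrite !mxE ord1 mulrC.
  apply: le_trans (is_norm_lincomb hN _ _) _; apply: ler_sum => i _.
  by rewrite -[leRHS]mulr1 ler_wpM2l ?normc_ge0.
have d0 : (0 < d)%N.
  rewrite lt0n; apply: contraNneq e0 => dE; apply/eqP/matrixP => -[k hk].
  by exfalso; rewrite dE in hk.
have [i yi] : exists i, N e <= d%:R * normc (y i 0).
  apply/not_existsP => h; move: Ney; apply/negP; rewrite -ltNge.
  have -> : N e = \sum_(i < d) (N e / d%:R).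
    by rewrite sumr_const card_ord -[RHS]mulr_natr divfK // pnatr_eq0 -lt0n.
  have ltr i : normc (y i 0) < N e / d%:R.
    by rewrite ltr_pdivlMr ?ltr0n // mulrC ltNge; apply/negP/h.
  apply: ltr_sum => //.
  by apply/hasP; exists (Ordinal d0); rewrite ?mem_index_enum.
have ny : 0 < normc (y i 0).
  by move: (lt_le_trans Ne yi); rewrite pmulr_rgt0 // ltr0n.
exists ((y i 0)^-1 *: row i (invmx V)) => [|x].
  rewrite -scalemxAl -row_mul mxE [row _ _ _ _]mxE mulVf //.
  by apply: contraTneq ny => ->; rewrite Normc.normc0 ltxx.
rewrite -scalemxAl -row_mul mxE [row _ _ _ _]mxE Normc.normcM Normc.normcV.
rewrite mulrC ler_pdivrMr // mulrAC ler_pdivlMr //.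
apply: le_trans (ler_pM (normc_ge0 _) (ltW Ne) (Vx x i) yi) _.
by rewrite le_eqVlt; apply/predU1P; left; ring.
Qed.

End OneNorm.

(** * Coordinates adapted to two norms *)

(** A partial dual basis: only the indices below [k] matter. The bounds on the
    vectors [e i] and on the dual forms [f i] give the two halves of a
    comparison which, for k = d, says that [N1] and [N2] are equivalent to the
    sums of the |x_i| and of the lam_i |x_i| respectively. *)
Record adapted (R : realType) (d : nat) (N1 N2 : 'cV[R[i]]_d -> R) (K : R)
    (k : nat) (e : nat -> 'cV[R[i]]_d) (f : nat -> 'rV[R[i]]_d)
    (lam : nat -> R) : Prop := Adapted {
  ad_dual : forall i j, (i < k)%N -> (j < k)%N ->
    (f i *m e j) 0 0 = (i == j)%:R;
  ad_pos : forall i, (i < k)%N -> 0 < lam i;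
  ad_vec1 : forall i, (i < k)%N -> N1 (e i) <= 1;
  ad_vec2 : forall i, (i < k)%N -> N2 (e i) <= lam i;
  ad_form1 : forall i x, (i < k)%N -> normc ((f i *m x) 0 0) <= K * N1 x;
  ad_form2 : forall i x, (i < k)%N -> lam i * normc ((f i *m x) 0 0) <= K * N2 x
}.

(** This is where the greedy construction finds room for one more vector. *)
Lemma exists_common_kernel (F : fieldType) (d k : nat) (f : nat -> 'rV[F]_d) :
  (k < d)%N -> exists2 x : 'cV[F]_d, x != 0 &
    forall i, (i < k)%N -> (f i *m x) 0 0 = 0.
Proof.
move=> kd; pose A := \matrix_(a < d, b < k) f b 0 a.
have kerA : kermx A != 0.
  rewrite -mxrank_eq0 mxrank_ker subn_eq0 -ltnNge.
  exact: leq_ltn_trans (rank_leq_col A) kd.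
exists (nz_row (kermx A))^T.
  by rewrite -(inj_eq (@trmx_inj _ _ _)) trmxK trmx0 nz_row_eq0.
move=> i ik; have /sub_kermxP := nz_row_sub (kermx A).
move=> /matrixP /(_ 0 (Ordinal ik)); rewrite mxE [RHS]mxE => <-; rewrite mxE.
by apply: eq_bigr => j _; rewrite !mxE mulrC.
Qed.

(** On the common kernel W of the forms, let E almost maximize N2 / N1, and let
    g almost norm E for N2. The new form is g composed with the projection Pi
    onto W along the previous vectors. Composing with Pi costs a factor
    1 + k K in both norms because the previous vectors and forms are adapted to
    both. The choice of g bounds the form for N2. For N1, the bound follows from
    N2 <= 2 (N2 E) N1 on W, which is how E was chosen. *)
Lemma adapted_step (R : realType) (d k : nat) (K : R) (N1 N2 : 'cV[R[i]]_d -> R)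
    e f lam :
  is_norm N1 -> is_norm N2 -> (k < d)%N -> 0 <= K ->
  adapted N1 N2 K k e f lam ->
  exists e' f' lam',
    adapted N1 N2 (K + 4 * d%:R * (1 + k%:R * K)) k.+1 e' f' lam'.
Proof.
move=> hN1 hN2 kd K0 [fe lam0 e1 e2 f1 f2].
pose Pi : 'M[R[i]]_d := 1%:M - \sum_(i < k) e i *m f i.
have PiE x : Pi *m x = x - \sum_(i < k) (f i *m x) 0 0 *: e i.
  rewrite mulmxBl mul1mx mulmx_suml; congr (_ - _); apply: eq_bigr => i _.
  by rewrite -mulmxA [f i *m x]mx11_scalar mul_mx_scalar !mxE eqxx mulr1n.
pose Q := 1 + k%:R * K.
have Q0 : 0 < Q by rewrite ltr_pwDl // mulr_ge0.
have Pi_le N (hN : is_norm N) x :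
    (forall i, (i < k)%N -> normc ((f i *m x) 0 0) * N (e i) <= K * N x) ->
    N (Pi *m x) <= Q * N x.
  move=> h; rewrite PiE; apply: le_trans (is_norm_triangle hN _ _) _.
  rewrite (is_normN hN) mulrDl mul1r lerD2l.
  apply: le_trans (is_norm_lincomb hN _ _) _.
  apply: (@le_trans _ _ (\sum_(i < k) K * N x)).
    by apply: ler_sum => i _; exact: h.
  by rewrite sumr_const card_ord -[leLHS]mulr_natl mulrA.
have Pi1 x : N1 (Pi *m x) <= Q * N1 x.
  apply: Pi_le => // i ik; apply: le_trans (f1 i x ik).
  by rewrite -[leRHS]mulr1 ler_wpM2l ?normc_ge0 ?e1.
have Pi2 x : N2 (Pi *m x) <= Q * N2 x.
  apply: Pi_le => // i ik; apply: le_trans (f2 i x ik).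
  by rewrite mulrC ler_wpM2r ?normc_ge0 ?e2.
have Pi_e j : (j < k)%N -> Pi *m e j = 0.
  move=> jk; rewrite PiE (bigD1 (Ordinal jk)) //= fe // eqxx scale1r big1.
    by rewrite addr0 subrr.
  move=> i ij; rewrite fe //.
  have /negbTE-> : nat_of_ord i != j.
    by apply: contra ij => /eqP ij; apply/eqP/val_inj.
  by rewrite scale0r.
(* Pi projects onto W. *)
pose W := [set x : 'cV[R[i]]_d | forall i, (i < k)%N -> (f i *m x) 0 0 = 0].
have WZ a x : W x -> W (a *: x).
  by move=> Wx i ik; rewrite -scalemxAr mxE Wx // mulr0.
have PiW x : W (Pi *m x).
  move=> i ik; rewrite PiE mulmxBr mulmx_sumr mxE [X in _ + X]mxE summxE.
  rewrite (bigD1 (Ordinal ik)) //= big1 => [|j ji].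
    by rewrite addr0 -scalemxAr [X in _ - X]mxE fe // eqxx mulr1 subrr.
  rewrite -scalemxAr mxE fe //.
  have /negbTE-> : i != j.
    by apply: contra ji => /eqP ij; apply/eqP/val_inj; rewrite /= ij.
  by rewrite mulr0.
have [c c0 cN1] := entries_le_is_norm hN1.
have [L L0 LN2] := is_norm_le_entries hN2.
have N12 x : N2 x <= L / c * N1 x.
  apply: le_trans (LN2 x) _; rewrite -mulrA ler_pM2l // mulrC ler_pdivlMr //.
  by rewrite mulrC.
have [x0 x00 Wx0] := exists_common_kernel f kd.
(* Almost maximizing N2 on the unit ball of N1 in W amounts, by homogeneity, to
   almost maximizing N2 / N1 on W. *)
have [E [[WE E1] E20 Emax]] : exists E, [/\ (W E /\ N1 E <= 1), 0 < N2 E &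
    forall y, W y /\ N1 y <= 1 -> N2 y <= 2 * N2 E].
  apply: (@near_max _ _ [set x | W x /\ N1 x <= 1] N2
    (((N1 x0)^-1%:C)%C *: x0) (L / c)).
  - by split; [exact: WZ|rewrite is_norm_normalize].
  - apply: (is_norm_gt0 hN2).
    apply: contraTneq (@ltr01 R) => h.
    by rewrite -(is_norm_normalize hN1 x00) h (is_norm0 hN1) ltxx.
  - move=> x [_ x1]; apply: le_trans (N12 x) _.
    by rewrite -[leRHS]mulr1 ler_pM2l // divr_gt0.
have Ele x : W x -> N2 x <= 2 * N2 E * N1 x.
  move=> Wx; have [->|xn0] := eqVneq x 0.
    by rewrite (is_norm0 hN1) (is_norm0 hN2) mulr0.
  have n1 := is_norm_gt0 hN1 xn0.
  have := Emax (((N1 x)^-1%:C)%C *: x); rewrite is_norm_normalize //.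
  rewrite (is_norm_scale_pos hN2) ?invr_gt0 // mulrC ler_pdivrMr //.
  by apply; split=> //; exact: WZ.
have En0 : E != 0.
  by apply: contraTneq E20 => ->; rewrite (is_norm0 hN2) ltxx.
have [g gE gle] := norming_functional hN2 En0.
have PiE0 : Pi *m E = E.
  rewrite PiE big1 ?subr0 // => i _; by rewrite WE ?scale0r.
have dK0 : 0 <= d%:R * Q by rewrite mulr_ge0 // ltW.
have KN1 x : 0 <= K * N1 x by rewrite mulr_ge0 ?(is_norm_ge0 hN1).
have KN2 x : 0 <= K * N2 x by rewrite mulr_ge0 ?(is_norm_ge0 hN2).
have dN1 x : 0 <= d%:R * Q * N1 x by rewrite mulr_ge0 ?(is_norm_ge0 hN1).
have dN2 x : 0 <= d%:R * Q * N2 x by rewrite mulr_ge0 ?(is_norm_ge0 hN2).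
exists (fun i => if i == k then E else e i),
       (fun i => if i == k then g *m Pi else f i),
       (fun i => if i == k then N2 E else lam i).
have cases i : (i < k.+1)%N -> (i == k) || (i < k)%N.
  by rewrite ltnS leq_eqVlt.
have lt_neq i : (i < k)%N -> (i == k) = false by move/ltn_eqF.
split.
- move=> i j /cases /orP[/eqP->|ik] /cases /orP[/eqP->|jk]; rewrite ?eqxx.
  + by rewrite -mulmxA PiE0 gE.
  + by rewrite lt_neq // -mulmxA Pi_e // mulmx0 mxE eq_sym lt_neq.
  + by rewrite lt_neq // WE.
  + by rewrite !lt_neq // fe.
- move=> i /cases /orP[/eqP->|ik]; first by rewrite eqxx.
  by rewrite lt_neq // lam0.
- move=> i /cases /orP[/eqP->|ik]; first by rewrite eqxx.
  by rewrite lt_neq // e1.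
- move=> i /cases /orP[/eqP->|ik]; first by rewrite eqxx.
  by rewrite lt_neq // e2.
- move=> i x /cases /orP[/eqP->|ik]; last first.
    rewrite lt_neq //; apply: le_trans (f1 i x ik) _; rewrite -/Q.
    by have := dN1 x; lra.
  rewrite eqxx -mulmxA; apply: le_trans (gle _) _; rewrite ler_pdivrMr //.
  apply: le_trans (_ : _ <= 2 * d%:R * (2 * N2 E * (Q * N1 x))) _.
    rewrite ler_wpM2l ?mulr_ge0 //; apply: le_trans (Ele _ (PiW x)) _.
    by rewrite ler_pM2l ?mulr_gt0.
  rewrite -subr_ge0 -/Q.
  have -> : (K + 4 * d%:R * Q) * N1 x * N2 E -
      2 * d%:R * (2 * N2 E * (Q * N1 x)) = K * N1 x * N2 E by ring.
  by rewrite mulr_ge0 // ltW.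
- move=> i x /cases /orP[/eqP->|ik]; last first.
    rewrite lt_neq //; apply: le_trans (f2 i x ik) _; rewrite -/Q.
    by have := dN2 x; lra.
  rewrite eqxx -mulmxA mulrC -ler_pdivlMr //; apply: le_trans (gle _) _.
  rewrite ler_pM2r ?invr_gt0 // -/Q.
  apply: le_trans (_ : _ <= 2 * d%:R * (Q * N2 x)) _.
    by rewrite ler_wpM2l ?mulr_ge0.
  by have := dN2 x; have := KN2 x; lra.
Qed.

Lemma exists_adapted (R : realType) (d k : nat) : (k <= d)%N ->
  exists2 K : R, 0 <= K & forall N1 N2 : 'cV[R[i]]_d -> R,
    is_norm N1 -> is_norm N2 -> exists e f lam, adapted N1 N2 K k e f lam.
Proof.
elim: k => [|k IH] kd.
  by exists 0 => // N1 N2 _ _; exists (fun=> 0), (fun=> 0), (fun=> 0); split.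
have [K K0 hK] := IH (ltnW kd).
exists (K + 4 * d%:R * (1 + k%:R * K)).
  by rewrite !addr_ge0 ?mulr_ge0 ?addr_ge0 ?mulr_ge0.
move=> N1 N2 h1 h2; have [e [f [lam h]]] := hK _ _ h1 h2.
exact: adapted_step h1 h2 kd K0 h.
Qed.

(** * Products of matrices with weighted entry bounds *)

Lemma set_prod0 (R : realType) (d : nat) (S : set 'M[R[i]]_d) X :
  set_prod S 0 X <-> X = 1%:M.
Proof.
split=> [[A _ <-]|->]; first by rewrite big_ord0.
by exists (fun=> 0) => [[]//|]; rewrite big_ord0.
Qed.

Lemma set_prod1 (R : realType) (d : nat) (S : set 'M[R[i]]_d) A :
  S A -> set_prod S 1 A.
Proof. by move=> SA; exists (fun=> A) => //; rewrite big_ord1. Qed.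

Lemma set_prod_recl (R : realType) (d : nat) (S : set 'M[R[i]]_d) n X :
  set_prod S n.+1 X <->
  exists A Y, [/\ S A, set_prod S n Y & X = A *m Y].
Proof.
split=> [[A SA <-]|[A [Y [SA [B SB <-] ->]]]].
  exists (A ord0), (\prod_(k < n) A (lift ord0 k)); split=> //.
    by exists (fun k => A (lift ord0 k)) => // k; exact: SA.
  by rewrite big_ord_recl.
exists (fun i => if unlift ord0 i is Some j then B j else A) => [k|].
  by case: (unlift ord0 k).
rewrite big_ord_recl unlift_none; congr (_ * _).
by apply: eq_bigr => k _; rewrite liftK.
Qed.

Lemma set_prodD (R : realType) (d : nat) (S : set 'M[R[i]]_d) m n X :
  set_prod S (m + n) X <->
  exists Y Z, [/\ set_prod S m Y, set_prod S n Z & X = Y *m Z].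
Proof.
elim: m X => [|m IH] X.
  split=> [SX|[Y [Z [/set_prod0 -> SZ ->]]]]; last by rewrite mul1mx.
  exists 1%:M, X; split; rewrite ?mul1mx //.
  exact/set_prod0.
rewrite addSn; split.
  move=> /set_prod_recl [A [Y [SA /IH [Z [T [SZ ST ->]]] ->]]].
  exists (A *m Z), T; split=> //; last by rewrite mulmxA.
  by apply/set_prod_recl; exists A, Z.
move=> [Y [Z [/set_prod_recl [A [T [SA ST ->]]] SZ ->]]].
apply/set_prod_recl; exists A, (T *m Z); split; rewrite ?mulmxA //.
by apply/IH; exists T, Z.
Qed.

(** Entry bounds for products, when the entries of all the factors are at most
    [a] and, after conjugation by the diagonal matrix of the [lam i], at most
    [r]. *)
Section Entries.
Variables (R : realType) (d : nat) (S : set 'M[R[i]]_d) (lam : 'I_d -> R).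
Variables (a r : R).
Hypotheses (lam0 : forall i, 0 < lam i) (r0 : 0 <= r).
Hypothesis Sa : forall A i j, S A -> normc (A i j) <= a.
Hypothesis Sr : forall A i j, S A -> lam i * normc (A i j) <= r * lam j.

Lemma entry_prod_le n X i j :
  set_prod S n X -> normc (X i j) <= (d%:R * a) ^+ n.
Proof.
elim: n X i j => [|n IH] X i j.
  move=> /set_prod0 ->; rewrite mxE expr0.
  by case: eqP => _; rewrite ?Normc.normc1 ?Normc.normc0.
move=> /set_prod_recl [A [Y [SA SY ->]]]; rewrite mxE.
apply: le_trans (normc_sum _ _ _) _.
apply: le_trans (_ : _ <= \sum_(l < d) a * (d%:R * a) ^+ n) _.
  apply: ler_sum => l _; rewrite Normc.normcM.
  by apply: ler_pM; rewrite ?normc_ge0 ?Sa ?IH.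
by rewrite sumr_const card_ord exprS -[leLHS]mulr_natl mulrA.
Qed.

(** The cardinal bounds the number of consecutive steps with strictly
    increasing weights starting at i, so a path with more steps contains a
    step from i' to l with lam l <= lam i', where the bound [r] applies. The
    induction peels off the first factor: either its step does not increase
    the weight, or the cardinal decreases strictly. *)
Lemma entry_prod_le_small n X i j :
  (#|[pred l | (lam i < lam l)%R]| < n)%N ->
  set_prod S n X -> normc (X i j) <= d%:R * r * (d%:R * a) ^+ n.-1.
Proof.
elim: n X i j => [//|n IH] X i j /= ci.
move=> /set_prod_recl [A [Y [SA SY ->]]]; rewrite mxE.
apply: le_trans (normc_sum _ _ _) _.
apply: le_trans (_ : _ <= \sum_(l < d) r * (d%:R * a) ^+ n) _; last first.
  by rewrite sumr_const card_ord -[leLHS]mulr_natl mulrA.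
apply: ler_sum => l _; rewrite Normc.normcM.
have [il|li] := ltP (lam i) (lam l); last first.
  apply: ler_pM; rewrite ?normc_ge0 ?(entry_prod_le _ _ SY) //.
  rewrite -(ler_pM2l (lam0 i)); apply: le_trans (Sr _ _ SA) _.
  by rewrite mulrC ler_wpM2r.
have cl : (#|[pred t | (lam l < lam t)%R]| < n)%N.
  move: ci; rewrite ltnS; apply: leq_trans.
  apply: proper_card; apply/properP; split.
    by apply/fintype.subsetP => t; rewrite !inE; exact: lt_trans.
  by exists l; rewrite !inE ?ltxx.
have n0 : (0 < n)%N by apply: leq_ltn_trans cl.
apply: le_trans
  (ler_pM (normc_ge0 _) (normc_ge0 _) (Sa _ _ SA) (IH _ _ j cl SY)) _.
rewrite -[in leRHS](prednK n0) exprS le_eqVlt.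
by apply/predU1P; left; ring.
Qed.

End Entries.

(** * The two norms inequality *)

(** As a supremum, [set_norm N S] is meaningful only for bounded sets, whereas
    this predicate makes sense for each bound [M] and passes to products. *)
Definition op_bounded (R : realType) (d : nat) (N : 'cV[R[i]]_d -> R)
    (S : set 'M[R[i]]_d) (M : R) :=
  forall A v, S A -> N (A *m v) <= M * N v.

Lemma set_prod_conj (R : realType) (d : nat) (S : set 'M[R[i]]_d)
    (E F : 'M[R[i]]_d) n X : E *m F = 1%:M -> F *m E = 1%:M ->
  set_prod S n X -> set_prod [set F *m A *m E | A in S] n (F *m X *m E).
Proof.
move=> EF FE; elim: n X => [|n IH] X.
  by move=> /set_prod0 ->; rewrite mulmx1 FE; apply/set_prod0.
move=> /set_prod_recl [A [Y [SA SY ->]]]; apply/set_prod_recl.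
exists (F *m A *m E), (F *m Y *m E); split; [by exists A|exact: IH|].
by rewrite !mulmxA -(mulmxA _ E F) EF mulmx1.
Qed.

(** In adapted coordinates, [entry_prod_le_small] applies to every entry of a
    product of d factors, since fewer than d indices have a larger weight
    than a given one. *)
Lemma two_norms_inequality (R : realType) (d : nat) :
  exists2 C : R, 0 <= C & forall (S : set 'M[R[i]]_d) N1 N2 s1 s2,
    is_norm N1 -> is_norm N2 -> 0 <= s1 -> 0 <= s2 ->
    op_bounded N1 S s1 -> op_bounded N2 S s2 ->
    op_bounded N1 (set_prod S d) (C * s2 * s1 ^+ d.-1).
Proof.
have [K K0 hK] := exists_adapted R (leqnn d).
exists (d%:R * d%:R * d%:R * K * K * (d%:R * K) ^+ d.-1).
  by rewrite !mulr_ge0 // exprn_ge0 // mulr_ge0.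
move=> S N1 N2 s1 s2 h1 h2 s10 s20 b1 b2 X v SX.
have [e [f [lam [fe lam0 e1 e2 f1 f2]]]] := hK N1 N2 h1 h2.
pose E := \matrix_(a < d, j < d) e j a 0.
pose F := \matrix_(j < d, b < d) f j 0 b.
have colE j : col j E = e j by apply/matrixP => a b; rewrite !mxE ord1.
have rowF j : row j F = f j by apply/matrixP => a b; rewrite !mxE ord1.
have FAE A i j : (F *m A *m E) i j = (f i *m (A *m e j)) 0 0.
  rewrite -rowF mulmxA -row_mul mxE [RHS]mxE; apply: eq_bigr => k _.
  by rewrite [row _ _ _ _]mxE [E _ _]mxE.
have FE : F *m E = 1%:M.
  apply/matrixP => i j; rewrite -[F]mulmx1 FAE mul1mx fe // mxE.
  by rewrite -val_eqE.
have EF := mulmx1C FE.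
have entry1 A i j : [set F *m A *m E | A in S] A -> normc (A i j) <= K * s1.
  move=> [B SB <-]; rewrite FAE; apply: le_trans (f1 _ _ (ltn_ord i)) _.
  rewrite ler_wpM2l //; apply: le_trans (b1 _ _ SB) _.
  by rewrite -[leRHS]mulr1 ler_wpM2l // e1.
have entry2 A (i j : 'I_d) : [set F *m A *m E | A in S] A ->
    lam i * normc (A i j) <= K * s2 * lam j.
  move=> [B SB <-]; rewrite FAE; apply: le_trans (f2 _ _ (ltn_ord i)) _.
  rewrite -mulrA ler_wpM2l //; apply: le_trans (b2 _ _ SB) _.
  by rewrite ler_wpM2l // e2.
pose D := d%:R * (K * s2) * (d%:R * (K * s1)) ^+ d.-1.
have XD i j : normc ((F *m X *m E) i j) <= D.
  have Ks2 : 0 <= K * s2 by rewrite mulr_ge0.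
  have lam0' (l : 'I_d) : 0 < lam l by exact: lam0.
  apply: (entry_prod_le_small lam0' Ks2 entry1 entry2 _ _
    (set_prod_conj EF FE SX)).
  rewrite -[ltnRHS](card_ord d); apply: proper_card; apply/properP.
  by split; [apply/fintype.subsetP|exists i; rewrite // inE ltxx].
have D0 : 0 <= D by rewrite !mulr_ge0 // exprn_ge0 // !mulr_ge0.
have N1v := is_norm_ge0 h1 v.
pose w := F *m X *m E *m (F *m v).
have -> : X *m v = \sum_(i < d) w i 0 *: e i.
  have -> : X *m v = E *m w.
    by rewrite /w !mulmxA EF mul1mx -(mulmxA X) EF mulmx1.
  apply/matrixP => a b; rewrite mxE summxE; apply: eq_bigr => i _.
  by rewrite -colE !mxE ord1 mulrC.
apply: le_trans (is_norm_lincomb h1 _ _) _.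
apply: le_trans (_ : _ <= \sum_(i < d) d%:R * (D * (K * N1 v))) _; last first.
  rewrite sumr_const card_ord -[leLHS]mulr_natl le_eqVlt; apply/predU1P; left.
  by rewrite /D !exprMn; ring.
apply: ler_sum => i _; apply: le_trans (_ : _ <= normc (w i 0)) _.
  by rewrite -[leRHS]mulr1 ler_wpM2l ?normc_ge0 // e1.
rewrite mxE; apply: le_trans (normc_sum _ _ _) _.
apply: le_trans (_ : _ <= \sum_(j < d) D * (K * N1 v)) _; last first.
  by rewrite sumr_const card_ord -[leLHS]mulr_natl.
apply: ler_sum => j _; rewrite Normc.normcM.
apply: ler_pM; rewrite ?normc_ge0 ?XD //.
have -> : (F *m v) j 0 = (f j *m v) 0 0 by rewrite -rowF -row_mul [RHS]mxE.
exact: f1.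
Qed.

(** * Operator norms of sets of matrices *)

Section OpNorm.
Variables (R : realType) (d : nat) (N : 'cV[R[i]]_d -> R).
Hypotheses (d0 : (0 < d)%N) (hN : is_norm N).
Implicit Types (S : set 'M[R[i]]_d) (M : R).

Lemma exists_unit_vector : exists v, N v = 1.
Proof.
have v0 : (const_mx 1 : 'cV[R[i]]_d) != 0.
  apply/eqP => /matrixP /(_ (Ordinal d0) 0); rewrite !mxE => /eqP.
  by rewrite oner_eq0.
by eexists; apply: (is_norm_normalize hN v0).
Qed.

Lemma op_norm_le A M : (forall v, N (A *m v) <= M * N v) -> op_norm N A <= M.
Proof.
move=> AM; apply: ge_sup.
  by have [v v1] := exists_unit_vector; exists (N (A *m v)), v.
by move=> _ [v v1 <-]; rewrite -[M]mulr1 -v1.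
Qed.

Lemma le_op_norm A M v : (forall v, N (A *m v) <= M * N v) ->
  N (A *m v) <= op_norm N A * N v.
Proof.
move=> AM; have [->|v0] := eqVneq v 0.
  by rewrite mulmx0 (is_norm0 hN) mulr0.
have Nv := is_norm_gt0 hN v0.
rewrite -ler_pdivrMr //; apply: ub_le_sup.
  by exists M => _ [u u1 <-]; rewrite -[M]mulr1 -u1.
exists (((N v)^-1%:C)%C *: v); first exact: is_norm_normalize.
by rewrite -scalemxAr (is_norm_scale_pos hN) ?invr_gt0 // mulrC.
Qed.

Lemma op_norm_ge0 A : 0 <= op_norm N A.
Proof.
have [[h0 h]|h] := pselect (has_sup [set N (A *m v) | v in [set v | N v = 1]]).
  case: h0 => x h0; apply: le_trans (ub_le_sup h h0).
  by case: h0 => v _ <-; exact: is_norm_ge0.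
by rewrite /op_norm sup_out.
Qed.

Lemma set_norm_le S M : S !=set0 -> op_bounded N S M -> set_norm N S <= M.
Proof.
move=> [A SA] SM; apply: ge_sup; first by exists (op_norm N A), A.
by move=> _ [B SB <-]; apply: op_norm_le => v; exact: SM.
Qed.

Lemma op_bounded_set_norm S M : op_bounded N S M ->
  op_bounded N S (set_norm N S).
Proof.
move=> SM A v SA; have Av u : N (A *m u) <= M * N u by exact: SM.
apply: le_trans (le_op_norm v Av) _; rewrite ler_wpM2r ?(is_norm_ge0 hN) //.
apply: ub_le_sup; last by exists A.
by exists M => _ [B SB <-]; apply: op_norm_le => u; exact: SM.
Qed.

Lemma set_norm_ge0 S : 0 <= set_norm N S.
Proof.
have [[h0 h]|h] := pselect (has_sup [set op_norm N A | A in S]).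
  case: h0 => x h0; apply: le_trans (ub_le_sup h h0).
  by case: h0 => A _ <-; exact: op_norm_ge0.
by rewrite /set_norm sup_out.
Qed.

Lemma op_bounded_prodD S m n a b : 0 <= a ->
  op_bounded N (set_prod S m) a -> op_bounded N (set_prod S n) b ->
  op_bounded N (set_prod S (m + n)) (a * b).
Proof.
move=> a0 Sa Sb X v /set_prodD [Y [Z [SY SZ ->]]].
rewrite -mulmxA; apply: le_trans (Sa _ _ SY) _.
by rewrite -mulrA ler_wpM2l // Sb.
Qed.

Lemma op_bounded_prod S M n : 0 <= M -> op_bounded N S M ->
  op_bounded N (set_prod S n) (M ^+ n).
Proof.
move=> M0 SM; elim: n => [|n IH] X v.
  by move=> /set_prod0 ->; rewrite mul1mx mul1r.
move=> /set_prod_recl [A [Y [SA SY ->]]]; rewrite -mulmxA exprS -mulrA.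
by apply: le_trans (SM _ _ SA) _; rewrite ler_wpM2l // IH.
Qed.

Lemma set_prod_nonempty S n : S !=set0 -> set_prod S n !=set0.
Proof. by move=> [A SA]; exists (\prod_(k < n) A), (fun=> A). Qed.

Lemma bounded_set_op_bounded S : bounded_set S ->
  exists2 M, 0 <= M & op_bounded N S M.
Proof.
move=> [B [Breal hB]].
have [c c0 cN] := entries_le_is_norm hN.
have [L L0 NL] := is_norm_le_entries hN.
(* B is only known to be real, while B1 is positive as well. *)
pose B1 : R[i] := `|B| + 1.
have BB1 : B < B1 by rewrite ltr_pwDr // real_ler_norm.
have entry A i j : S A -> normc (A i j) <= complex.Re B1.
  move=> SA; have := hB _ BB1 A SA; rewrite /Num.Def.normr /= => AB.
  have : `|A i j| <= B1.
    by apply: le_trans AB; exact: normr_entry_le.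
  by rewrite lecE => /andP[_]; rewrite normc_def; case: (A i j).
pose b := complex.Re B1.
have b0 : 0 <= b.
  have : 0 <= B1 by rewrite /B1 addr_ge0.
  by rewrite /b; case: B1 {BB1 entry b} => p q; rewrite lecE /= => /andP[].
exists (L * (d%:R * b / c)).
  by rewrite mulr_ge0 ?(ltW L0) // divr_ge0 ?(ltW c0) // mulr_ge0.
move=> A v SA; apply: le_trans (NL _) _; rewrite -[leRHS]mulrA ler_pM2l //.
apply: le_trans (_ : _ <= \sum_(i < d) b * (c^-1 * N v)) _; last first.
  by rewrite sumr_const card_ord -[leLHS]mulr_natl !mulrA.
apply: ler_sum => i _; rewrite mxE; apply: le_trans (normc_sum _ _ _) _.
apply: le_trans (_ : _ <= b * \sum_j normc (v j 0)) _.
  rewrite mulr_sumr; apply: ler_sum => j _.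
  by rewrite Normc.normcM ler_wpM2r ?normc_ge0 ?entry.
by rewrite ler_wpM2l // mulrC ler_pdivlMr // mulrC.
Qed.

End OpNorm.

(** * Growth of submultiplicative sequences *)

(** Write n = q m + s with s < m and use a_n <= (a_m) ^ q a_s; the constant
    collects the finitely many a_s / r ^ s. *)
Lemma submul_geometric (R : realType) (a : nat -> R) (r : R) (m : nat) :
  (forall n, 0 <= a n) -> (forall p q, a (p + q)%N <= a p * a q) ->
  0 < r -> (0 < m)%N -> a m <= r ^+ m ->
  exists2 K, 0 < K & forall n, a n <= K * r ^+ n.
Proof.
move=> a0 asub r0 m0 am.
pose K := 1 + \sum_(s < m) a s / r ^+ s.
have K0 : 0 < K.
  rewrite ltr_pwDl // sumr_ge0 // => s _.
  by rewrite divr_ge0 // exprn_ge0 // ltW.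
exists K => //.
elim/ltn_ind => n IH; have [nm|mn] := ltnP n m.
  rewrite -ler_pdivrMr ?exprn_gt0 // /K (bigD1 (Ordinal nm)) //= addrCA lerDl.
  rewrite addr_ge0 // sumr_ge0 // => s _.
  by rewrite divr_ge0 // exprn_ge0 // ltW.
rewrite -{1}(subnKC mn); apply: le_trans (asub _ _) _.
have lt : (n - m < n)%N by rewrite ltn_subrL m0 (leq_trans m0).
apply: le_trans (ler_pM (a0 _) (a0 _) am (IH _ lt)) _.
by rewrite mulrCA -exprD subnKC.
Qed.

Lemma powR_inv_le (R : realType) (x r : R) (n : nat) :
  (0 < n)%N -> 0 <= x -> 0 <= r -> (x `^ n%:R^-1 <= r) = (x <= r ^+ n).
Proof.
move=> n0 x0 r0.
have nR : (n%:R : R) != 0 by rewrite pnatr_eq0 -lt0n.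
rewrite -(ler_pXn2r n0) ?nnegrE ?powR_ge0 //.
suff -> : (x `^ n%:R^-1) ^+ n = x by [].
by rewrite -powR_mulrn ?powR_ge0 // -powRrM mulVf // powRr1.
Qed.

(** If the infimum l of the roots is less than r, some a_m is at most r ^ m, so
    a_n <= K r ^ n for all n by [submul_geometric]; the constant K disappears
    in the limit of the roots. *)
Lemma fekete (R : realType) (a : nat -> R) :
  (forall n, 0 <= a n) -> (forall p q, a (p + q)%N <= a p * a q) ->
  exists2 l : R, 0 <= l & (fun n => a n `^ n%:R^-1) @ \oo --> l /\
    forall r, l < r -> exists2 m, (0 < m)%N & a m <= r ^+ m.
Proof.
move=> a0 asub; pose u n := a n `^ n%:R^-1.
pose E := [set u n | n in [set n | (0 < n)%N]].
have E0 : E !=set0 by exists (u 1%N), 1%N.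
have lbE : lbound E 0 by move=> _ [n _ <-]; exact: powR_ge0.
have hinf : has_inf E by split; [|exists 0].
have l0 : 0 <= inf E by apply: lb_le_inf.
have small r : inf E < r -> exists2 m, (0 < m)%N & a m <= r ^+ m.
  move=> lr; have e0 : 0 < r - inf E by rewrite subr_gt0.
  have [_ [m m0 <-]] := inf_adherent e0 hinf.
  rewrite addrC subrK => um; exists m => //.
  by rewrite -powR_inv_le // ?ltW // (le_lt_trans l0).
exists (inf E) => //; split=> //.
apply/cvgrPdist_le => e e0.
(* The root of a_n is at most inf E + e as soon as K r ^ n <= (inf E + e) ^ n,
   which holds for large n because r < inf E + e. *)
pose r := inf E + e / 2.
have rl : inf E < r by rewrite ltrDl divr_gt0.
have r0 : 0 < r by apply: le_lt_trans rl.
have [m m0 am] := small _ rl.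
have [K K0 aK] := submul_geometric a0 asub r0 m0 am.
have le0 : 0 < inf E + e by rewrite ltr_wpDl.
have q1 : `|r / (inf E + e)| < 1.
  rewrite gtr0_norm ?divr_gt0 // ltr_pdivrMr // mul1r ltrD2l; lra.
have /cvgrPdist_lt /(_ K^-1) := cvg_expr q1.
rewrite invr_gt0 => /(_ K0) [n0 _ hn0].
exists (maxn 1 n0) => // n /=; rewrite geq_max => /andP[n1 nn0].
have un : inf E <= u n by apply: ge_inf; [exists 0|exists n].
rewrite distrC ger0_norm ?subr_ge0 // lerBlDl powR_inv_le ?(ltW le0) //.
apply: le_trans (aK n) _.
have := hn0 n nn0; rewrite /= sub0r normrN normrX gtr0_norm ?divr_gt0 //.
rewrite expr_div_n ltr_pdivrMr ?exprn_gt0 // => h.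
by rewrite mulrC -ler_pdivlMr // mulrC ltW.
Qed.

(** * Extremal norms *)

(** The norm of Rota and Strang. As the supremum ranges over products of all
    lengths, applying one more element of [S] shifts the family and costs only
    a factor [r]. *)
Definition extremal_norm (R : realType) (d : nat) (N : 'cV[R[i]]_d -> R)
    (S : set 'M[R[i]]_d) (r : R) (v : 'cV[R[i]]_d) : R :=
  sup [set x | exists n X, set_prod S n X /\ x = r ^- n * N (X *m v)].

Section ExtremalNorm.
Variables (R : realType) (d : nat) (N : 'cV[R[i]]_d -> R).
Variables (S : set 'M[R[i]]_d) (r K : R).
Hypotheses (hN : is_norm N) (r0 : 0 < r).
Hypothesis SK : forall n, op_bounded N (set_prod S n) (K * r ^+ n).
Local Notation N2 := (extremal_norm N S r).

Lemma extremal_norm_ge n X v : set_prod S n X -> r ^- n * N (X *m v) <= N2 v.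
Proof.
move=> SX; apply: ub_le_sup; last by exists n, X.
exists (K * N v) => _ [k [Y [SY ->]]].
rewrite mulrC ler_pdivrMr ?exprn_gt0 // mulrAC; exact: SK.
Qed.

Lemma extremal_norm_le v M :
  (forall n X, set_prod S n X -> r ^- n * N (X *m v) <= M) -> N2 v <= M.
Proof.
move=> h; apply: ge_sup; last by move=> _ [n [X [SX ->]]]; exact: h.
by exists (r ^- 0 * N (1%:M *m v)), 0%N, 1%:M; split=> //; apply/set_prod0.
Qed.

Lemma extremal_norm_ge_self v : N v <= N2 v.
Proof.
have S1 : set_prod S 0 1%:M by apply/set_prod0.
by have := extremal_norm_ge v S1; rewrite expr0 invr1 mul1r mul1mx.
Qed.

Lemma extremal_norm_is_norm : is_norm N2.
Proof.
have homog (a : R[i]) v : N2 (a *: v) <= normc a * N2 v.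
  apply: extremal_norm_le => n X SX.
  rewrite -scalemxAr (is_norm_homog hN) mulrCA ler_wpM2l ?normc_ge0 //.
  exact: extremal_norm_ge.
split.
- move=> u v; apply: extremal_norm_le => n X SX.
  apply: le_trans (lerD (extremal_norm_ge u SX) (extremal_norm_ge v SX)).
  rewrite -mulrDr ler_wpM2l ?invr_ge0 ?exprn_ge0 ?(ltW r0) //.
  by rewrite mulmxDr; exact: (is_norm_triangle hN).
- move=> a v; apply/eqP; rewrite eq_le homog /=.
  have [->|a0] := eqVneq a 0.
    rewrite Normc.normc0 mul0r scale0r -(is_norm0 hN).
    exact: extremal_norm_ge_self.
  have na : 0 < normc a.
    rewrite lt_neqAle normc_ge0 andbT eq_sym.
    by apply: contra a0 => /eqP /Normc.eq0_normc ->.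
  rewrite mulrC -ler_pdivlMr // mulrC -Normc.normcV.
  by have := homog a^-1 (a *: v); rewrite scalerA mulVf // scale1r.
- move=> v v0; apply: (is_norm_eq0 hN); apply/eqP.
  by rewrite eq_le (is_norm_ge0 hN) andbT -v0 extremal_norm_ge_self.
Qed.

(** For X in S^n and A in S the product X A lies in S^(n+1), so
    r^-n N (X A v) = r r^-(n+1) N (X A v) <= r N2 v. *)
Lemma extremal_norm_op_bounded : op_bounded N2 S r.
Proof.
move=> A v SA; apply: extremal_norm_le => n X SX.
have SXA : set_prod S n.+1 (X *m A).
  by rewrite -addn1; apply/set_prodD; exists X, A; split=> //; exact: set_prod1.
have := extremal_norm_ge v SXA; rewrite exprS invfM mulmxA -mulrA.
by rewrite mulrC ler_pdivrMr // [N2 v * r]mulrC.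
Qed.

End ExtremalNorm.

(** * Bochi's inequality *)

Theorem theorem1 (R : realType) (d : nat) (hd : (1 <= d)%N) :
  exists C1 : R, 1 < C1 /\
    forall (Sigma : set 'M[R[i]]_d) (N : 'cV[R[i]]_d -> R),
      Sigma !=set0 -> bounded_set Sigma -> is_norm N ->
      set_norm N (set_prod Sigma d) <=
        C1 * joint_spectral_radius N Sigma * set_norm N Sigma ^+ (d - 1).
Proof.
have [C C0 hC] := two_norms_inequality R d.
exists (C + 2); split; first lra.
move=> S N S0 Sbd hN; have [M M0 SM] := bounded_set_op_bounded hN Sbd.
set s := set_norm N S; pose a n := set_norm N (set_prod S n).
have s0 : 0 <= s by exact: set_norm_ge0.
have Ss : op_bounded N S s by exact: op_bounded_set_norm SM.
have a0 n : 0 <= a n by exact: set_norm_ge0.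
have Sa n : op_bounded N (set_prod S n) (a n).
  apply: op_bounded_set_norm => //; exact: op_bounded_prod SM.
have asub p q : a (p + q)%N <= a p * a q.
  apply: set_norm_le => //; first exact: set_prod_nonempty.
  exact: op_bounded_prodD.
have [l l0 [al small]] := fekete a0 asub.
have -> : joint_spectral_radius N S = l by apply/cvg_lim.
have main r : l < r -> a d <= C * r * s ^+ d.-1.
  move=> lr; have r0 : 0 < r by apply: le_lt_trans lr.
  have [m m0 am] := small _ lr.
  have [K K0 aK] := submul_geometric a0 asub r0 m0 am.
  have SK n : op_bounded N (set_prod S n) (K * r ^+ n).
    move=> X v SX; apply: le_trans (Sa n _ _ SX) _.
    by rewrite ler_wpM2r ?(is_norm_ge0 hN).
  apply: set_norm_le => //; first exact: set_prod_nonempty.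
  apply: hC s0 (ltW r0) Ss (extremal_norm_op_bounded r0 SK) => //.
  exact: extremal_norm_is_norm SK.
rewrite subn1; apply: le_trans (_ : C * l * s ^+ d.-1 <= _); last first.
  rewrite ler_wpM2r ?exprn_ge0 // ler_wpM2r //; lra.
have D0 : 0 <= C * s ^+ d.-1 by rewrite mulr_ge0 ?exprn_ge0.
(* Let r tend to l; the denominator 1 + C s^(d-1) cannot vanish. *)
apply/ler_addgt0Pr => e e0.
have D1 : 0 < C * s ^+ d.-1 + 1 by rewrite ltr_wpDl.
apply: le_trans (main (l + e / (C * s ^+ d.-1 + 1)) _) _.
  by rewrite ltrDl divr_gt0.
rewrite mulrDr mulrDl lerD2l mulrAC mulrA ler_pdivrMr //.
by rewrite mulrC ler_pM2l // lerDl.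
Qed.
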